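(* Let $a_{nm}=\int_{\mathbb{R}}\psi_n(v)\psi_m(v)\,dv$ for $n,m\ge0$ and, for $N\ge0$, let $A_{11}^N=(a_{nm})_{0\le n,m\le N}$. Let $N\ge1$ and partition $$A_{11}^N=\begin{pmatrix}A_{11}^{N-1}&X\\ X^\top&a_{NN}\end{pmatrix},\qquad A_{11}^{N-1}\in\mathbb{R}^{N\times N},\quad X\in\mathbb{R}^{N\times1},\quad a_{NN}\in\mathbb{R}.$$ Since $A_{11}^{N-1}$ is invertible, the Schur complement of $A_{11}^{N-1}$ in $A_{11}^N$ is given by $A_{11}^N/A_{11}^{N-1}:=a_{NN}-X^\top(A_{11}^{N-1})^{-1}X$. Moreover, this Schur complement is given explicitly by $$A_{11}^N/A_{11}^{N-1}=2^{-N-\frac12}.$$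
   Context: $T>0$ is fixed and $\psi_n(v)=\left(2^n n!\sqrt{\pi T}\right)^{-1/2}H_n\!\left(\frac{v}{\sqrt T}\right)e^{-v^2/T}$ for $n\in\mathbb{N}$ ($\mathbb{N}$ contains $0$), where $H_n$ is the (physicists') Hermite polynomial of degree $n$, with positive leading coefficient and $\int_{\mathbb{R}}H_nH_m e^{-v^2}\,dv=\sqrt{\pi}\,2^m m!\,\delta_{n,m}$. *)

(* Defs.v *)
From HB Require Import structures.
From mathcomp Require Import all_boot all_order all_algebra.
From mathcomp Require Import all_classical all_reals all_analysis.

Set Implicit Arguments.
Unset Strict Implicit.
Unset Printing Implicit Defensive.

Import Order.TTheory GRing.Theory Num.Theory.
Import numFieldNormedType.Exports.

Local Open Scope ring_scope.

(* Physicists' normalization: the recurrence is the Rodrigues formula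
   H_n(x) = (-1)^n e^(x^2) (d/dx)^n e^(-x^2), differentiated once; so
   H_0 = 1, H_1 = 2x, H_2 = 4x^2 - 2, and lead_coef H_n = 2^n. *)
Fixpoint hermite (R : realType) (n : nat) : {poly R} :=
  if n is m.+1 then 2 *: ('X * hermite R m) - (hermite R m)^`()
  else 1.

Definition psi (R : realType) (T : R) (n : nat) (v : R) : R :=
  (2 ^+ n * n`!%:R * Num.sqrt (pi * T)) `^ (- 2^-1)
  * (hermite R n).[v / Num.sqrt T] * expR (- (v ^+ 2 / T)).

Definition a (R : realType) (T : R) (n m : nat) : R :=
  \int[@lebesgue_measure R]_v (psi T n v * psi T m v).

(* Indexed by its size: the matrix (a_nm) with 0 <= n, m <= N is
   [A11 T (N + 1)], and the one with 0 <= n, m <= N - 1 is [A11 T N]. *)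
Definition A11 (R : realType) (T : R) (k : nat) : 'M[R]_k :=
  \matrix_(i < k, j < k) a T i j.

(* Schur complement of the upper left block; it is meaningful only when that
   block is invertible ([invmx] is the identity on singular matrices). *)
Definition schur_compl (R : realType) (m k : nat) (M : 'M[R]_(m + k)) : 'M[R]_k :=
  drsubmx M - dlsubmx M *m invmx (ulsubmx M) *m ursubmx M.

(* Main.v *)
(* Write L p for the integral of p(v) exp(- 2 v^2 / T). Integration by parts gives
   L('X p) = (T / 4) L(p'), so the Rodrigues-type polynomials K_0 = 1,
   K_(n+1) = 'X K_n - (T / 4) K_n' satisfy L(K_n q) = (T / 4)^n L(q^(n)): they are
   monic and orthogonal for L, with L(K_n^2) = (T / 4)^n n! L(1). The polynomial
   parts of the psi_n are triangular over the same monomials, so the Gram matrix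
   A11 has determinant the product of the (lead psi_n)^2 L(K_n^2) = 2^(- n - 1/2),
   and the Schur complement is the quotient of two consecutive determinants. *)
Require Import Defs.
From HB Require Import structures.
From mathcomp Require Import all_boot all_order all_algebra.
From mathcomp Require Import all_classical all_reals all_analysis.
From mathcomp Require Import measurable_realfun ring lra.

Set Implicit Arguments.
Unset Strict Implicit.
Unset Printing Implicit Defensive.

Import Order.TTheory GRing.Theory Num.Theory.
Import numFieldNormedType.Exports.

Local Open Scope ring_scope.

(** * Determinants and Schur complements *)

Lemma det_schur_compl (R : realType) (m k : nat) (M : 'M[R]_(m + k)) :
  ulsubmx M \in unitmx -> \det M = \det (ulsubmx M) * \det (schur_compl M).
Proof.
move=> uA.
rewrite -[in LHS](submxK M).
set A := ulsubmx M; set B := ursubmx M; set C := dlsubmx M; set D := drsubmx M.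
(* Block LU factorization: the unipotent left factor carries [C *m invmx A], and both factors are
   block triangular. *)
have -> : block_mx A B C D =
    block_mx 1%:M 0 (C *m invmx A) 1%:M *m block_mx A B 0 (schur_compl M).
  rewrite mulmx_block !mul1mx !mul0mx ?mulmx0 !addr0 /schur_compl.
  by rewrite -/A -/B -/C -/D mulmxKV// addrC subrK.
by rewrite det_mulmx det_lblock det_ublock !det1 !mul1r.
Qed.

(** * Gram determinants of a linear functional on polynomials *)

Section gram.
Variables (R : comNzRingType) (L : {scalar {poly R}}).

Let coef_mx n (p : nat -> {poly R}) : 'M[R]_n := \matrix_(i, j) (p i)`_j.

(** Expanding both families in monomials turns the Gram matrix into the Hankel matrix of moments
    between two triangular coefficient matrices. *)
Let gram_hankel n (p q : nat -> {poly R}) :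
  (forall i, (size (p i) <= i.+1)%N) -> (forall i, (size (q i) <= i.+1)%N) ->
  \matrix_(i < n, j < n) L (p i * q j) =
  coef_mx n p *m (\matrix_(i < n, j < n) L ('X^i * 'X^j)) *m (coef_mx n q)^T.
Proof.
have expand (r : {poly R}) (i : 'I_n) : (size r <= i.+1)%N ->
    r = \sum_(j < n) r`_j *: 'X^j.
  move=> sr; apply/polyP => j; rewrite coef_sum.
  under eq_bigr do rewrite coefZ coefXn.
  have [jn|nj] := ltnP j n.
    rewrite (bigD1 (Ordinal jn))//= eqxx mulr1 big1 ?addr0// => l lj.
    rewrite eq_sym (_ : (_ == _) = false) ?mulr0//.
    by apply: contraNF lj => /eqP lj; apply/eqP/val_inj.
  rewrite big1 => [|l _]; last first.
    by rewrite eq_sym ltn_eqF ?mulr0// (leq_trans (ltn_ord l)).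
  by rewrite nth_default// (leq_trans sr)// (leq_trans (ltn_ord i)).
move=> sp sq; apply/matrixP => i j; rewrite !mxE.
rewrite [X in L (X * _)](expand _ i (sp i)) [X in L (_ * X)](expand _ j (sq j)).
rewrite mulr_sumr linear_sum; apply: eq_bigr => l _; rewrite !mxE.
rewrite [in LHS]mulr_suml linear_sum [RHS]mulr_suml.
apply: eq_bigr => h _; rewrite !mxE.
by rewrite -scalerAl -scalerAr !linearZ /=; ring.
Qed.

Let det_coef_mx n (p : nat -> {poly R}) : (forall i, (size (p i) <= i.+1)%N) ->
  \det (coef_mx n p) = \prod_(i < n) (p i)`_i.
Proof.
move=> sp; rewrite det_trig; first by apply: eq_bigr => i _; rewrite mxE.
apply/is_trig_mxP => i j ij; rewrite mxE nth_default//.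
exact: leq_trans (sp i) _.
Qed.

Variable c : R.

(* For the weight exp(- x^2 / (2 c)) these are the monic orthogonal polynomials. *)
Fixpoint orthopoly (n : nat) : {poly R} :=
  if n is m.+1 then 'X * orthopoly m - c *: (orthopoly m)^`() else 1.

Lemma size_orthopoly n : (size (orthopoly n) <= n.+1)%N.
Proof.
elim: n => [|n IH] /=; first by rewrite size_poly1.
rewrite (leq_trans (size_polyD _ _))// geq_max size_polyN.
rewrite (leq_trans (size_polyMleq _ _)) ?size_polyX//=.
rewrite (leq_trans (size_scale_leq _ _))//.
by rewrite (leq_trans (size_poly _ _))// (leq_trans (leq_pred _))// ltnW.
Qed.

Lemma coef_orthopoly n : (orthopoly n)`_n = 1.
Proof.
elim: n => [|n IH] /=; first by rewrite coef1.
rewrite coefB coefXM/= IH coefZ coef_deriv nth_default ?mul0rn ?mulr0 ?subr0//.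
exact: leq_trans (size_orthopoly n) _.
Qed.

Hypothesis L_ibp : forall p, L ('X * p) = c * L p^`().

(** By [L_ibp] and the product rule, L(X K_n q) = c L(K_n' q) + c L(K_n q'). The subtracted term of
    K_(n+1) cancels the first summand, so each step lowers the index and differentiates q once. *)
Lemma orthopolyE n q : L (orthopoly n * q) = c ^+ n * L q^`(n).
Proof.
elim: n q => [|n IH] q /=; first by rewrite !mul1r.
rewrite mulrBl -mulrA linearB /= L_ibp derivM linearD /= -scalerAl linearZ /=.
by rewrite mulrDr addrC addKr IH -derivSn exprS mulrA.
Qed.

Lemma det_gram n (p : nat -> {poly R}) : (forall i, (size (p i) <= i.+1)%N) ->
  \det (\matrix_(i < n, j < n) L (p i * p j)) =
  \prod_(i < n) ((p i)`_i ^+ 2 * (c ^+ i * i`!%:R * L 1)).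
Proof.
move=> sp.
(* The factorization is applied twice: to the K_i, whose coefficient matrix has determinant 1, to
   evaluate the Hankel determinant, and later to p. *)
have dH : \det (\matrix_(i < n, j < n) L ('X^i * 'X^j)) =
    \prod_(i < n) (c ^+ i * i`!%:R * L 1).
  have := congr1 determinant (gram_hankel n size_orthopoly size_orthopoly).
  rewrite !det_mulmx det_tr det_coef_mx; last exact: size_orthopoly.
  rewrite big1 ?mul1r ?mulr1; last by move=> i _; rewrite coef_orthopoly.
  (* After transposing, an entry with i < j is c^j L(K_i^(j)), which vanishes because K_i has degree
     at most i. *)
  move=> <-; rewrite -det_tr det_trig; last first.
    apply/is_trig_mxP => i j ij; rewrite !mxE orthopolyE.
    rewrite derivn_poly0 ?linear0 ?mulr0//.
    exact: leq_trans (size_orthopoly i) _.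
  apply: eq_bigr => i _; rewrite !mxE orthopolyE -mulrA; congr (_ * _).
  (* The i-th derivative of a monic polynomial of degree i is the constant i!. *)
  rewrite [X in L X](_ : _ = i`!%:R *: 1) ?linearZ//.
  apply/polyP => j; rewrite coef_derivn coefZ coef1.
  have [->|j0] := posnP j; first by rewrite addn0 coef_orthopoly ffactnn mulr1.
  rewrite mulr0 nth_default ?mul0rn//.
  by rewrite (leq_trans (size_orthopoly _))// -addn1 leq_add2l.
rewrite gram_hankel// !det_mulmx det_tr dH det_coef_mx//.
by rewrite mulrAC -!big_split /=; apply: eq_bigr => i _; rewrite expr2.
Qed.

End gram.

(** * Growth and integrability for Gaussian weights *)

Lemma horner_le_expR_sqr (R : realType) (p : {poly R}) (e : R) : 0 < e ->
  exists C, forall x, `|p.[x]| <= C * expR (e * x ^+ 2).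
Proof.
elim/poly_ind: p e => [|p c IH] e e0; have ge0e := ltW e0.
  by exists 0 => x; rewrite horner0 normr0 mul0r.
(* Half of the exponent serves the induction hypothesis; the other half absorbs the factor x of the
   Horner step, through |x| <= 1 + x^2 and 1 + y <= exp y. *)
have e2 : 0 < e / 2 by rewrite divr_gt0.
have [C pC] := IH _ e2.
have C0 : 0 <= C.
  have := pC 0; rewrite expr0n/= mulr0 expR0 mulr1; exact: le_trans.
exists (C * (1 + 2 / e) + `|c|) => x; rewrite hornerMXaddC.
rewrite (le_trans (ler_normD _ _))// mulrDl lerD//; last first.
  by rewrite ler_peMr// -expR0 ler_expR mulr_ge0 ?sqr_ge0// ltW.
have -> : expR (e * x ^+ 2) = expR (e / 2 * x ^+ 2) * expR (e / 2 * x ^+ 2).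
  by rewrite -expRD -mulrDl -splitr.
rewrite normrM mulrACA ler_pM//.
have x1 : `|x| <= 1 + x ^+ 2.
  rewrite -real_normK ?num_real//.
  have := sqr_ge0 (`|x| - 1); have := normr_ge0 x; nra.
apply: (le_trans x1).
apply: (@le_trans _ _ ((1 + 2 / e) * (1 + e / 2 * x ^+ 2))); last first.
  by rewrite ler_wpM2l ?expR_ge1Dx// addr_ge0// divr_ge0// ltW.
have -> : (1 + 2 / e) * (1 + e / 2 * x ^+ 2) =
    1 + x ^+ 2 + (2 / e + e / 2 * x ^+ 2).
  by field; rewrite gt_eqF.
by rewrite lerDl addr_ge0 ?divr_ge0// mulr_ge0 ?sqr_ge0// ltW.
Qed.

Section gaussian_weight.
Variables (R : realType) (k : {posnum R}).
Local Notation mu := (@lebesgue_measure R).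
Local Notation w := (fun x : R => expR (- (k%:num * x ^+ 2))).

(** The standard deviation for which the centred normal density is proportional to [w];
    integrability and total mass then come from the normal law. *)
Let sigma : R := Num.sqrt ((2 * k%:num)^-1).

Let sigma0 : sigma != 0.
Proof. by rewrite gt_eqF// sqrtr_gt0 invr_gt0 mulr_gt0. Qed.

Let normal_pdf_gauss x : normal_pdf 0 sigma x = Num.sqrt (k%:num / pi) * w x.
Proof.
have k0 : k%:num != 0 by [].
rewrite normal_pdfE// /normal_peak /normal_fun subr0.
rewrite sqr_sqrtr ?invr_ge0 ?mulr_ge0// -sqrtrV; last first.
  by rewrite mulrn_wge0// mulr_ge0 ?pi_ge0// invr_ge0 mulr_ge0.
have pi0 : pi != 0 :> R by rewrite gt_eqF// pi_gt0.
move: (pi : R) pi0 (k%:num : R) k0 => P P0 K K0.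
by congr (Num.sqrt _ * expR _); rewrite -mulr_natr; field; rewrite ?P0.
Qed.

Let sqrt_gt0 : 0 < Num.sqrt (k%:num / pi) :> R.
Proof. by rewrite sqrtr_gt0 divr_gt0// pi_gt0. Qed.

Lemma integrable_gauss : mu.-integrable setT (EFin \o w).
Proof.
have := integrable_normal_pdf 0 sigma.
move/(integrableZl measurableT (Num.sqrt (k%:num / pi))^-1).
apply: eq_integrable => // x _.
by rewrite -EFinM normal_pdf_gauss mulKf// gt_eqF.
Qed.

Lemma Rintegral_gauss : \int[mu]_x w x = Num.sqrt (pi / k%:num).
Proof.
have := congr1 fine (integral_normal_pdf 0 sigma).
rewrite -[fine _]/(\int[mu]_x normal_pdf 0 sigma x)%R.
under eq_Rintegral do rewrite normal_pdf_gauss.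
rewrite RintegralZl//; last exact: integrable_gauss.
move=> /= /(canRL (mulKf _)) ->; last by rewrite gt_eqF.
by rewrite mulr1 -sqrtrV ?invf_div// divr_ge0// pi_ge0.
Qed.

Lemma continuous_gauss : continuous w.
Proof.
move=> x; apply: continuous_comp; last exact: continuous_expR.
apply: cvgN; apply: cvgM; first exact: cvg_cst.
exact: exprn_continuous.
Qed.

Lemma continuous_poly_gauss (p : {poly R}) : continuous (fun x => p.[x] * w x).
Proof.
move=> x; apply: cvgM; first exact: continuous_horner.
exact: continuous_gauss.
Qed.

(** Half of the Gaussian decay is spent on the polynomial. What remains serves both as an integrable
    majorant and for the vanishing at infinity. *)
Lemma poly_gauss_bound (p : {poly R}) :
  exists C, forall x, `|p.[x] * w x| <= C * expR (- (k%:num / 2 * x ^+ 2)).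
Proof.
have [C pC] := horner_le_expR_sqr p (divr_gt0 [gt0 of k%:num] (ltr0n _ 2)).
exists C => x; rewrite normrM (ger0_norm (expR_ge0 _)).
apply: le_trans (ler_wpM2r (expR_ge0 _) (pC x)) _.
rewrite -[leLHS]mulrA -expRD le_eqVlt; apply/predU1P; left; congr (_ * expR _).
by field.
Qed.

End gaussian_weight.

(** * The Gaussian functional and integration by parts *)

Section gaussian_functional.
Variables (R : realType) (k : {posnum R}).
Local Notation mu := (@lebesgue_measure R).
Local Notation w := (fun x : R => expR (- (k%:num * x ^+ 2))).

Lemma integrable_poly_gauss (p : {poly R}) :
  mu.-integrable setT (EFin \o (fun x => p.[x] * w x)).
Proof.
have [C pC] := poly_gauss_bound k p.
have k2 : 0 < k%:num / 2 by [].
have h := integrableZl measurableT C (integrable_gauss (PosNum k2)).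
apply: (le_integrable measurableT _ _ h).
  apply/measurable_EFinP; apply: continuous_measurable_fun.
  exact: continuous_poly_gauss.
move=> x _ /=; rewrite lee_fin; apply: le_trans (pC x) _; exact: ler_norm.
Qed.

Definition gauss_functional (p : {poly R}) : R := \int[mu]_x (p.[x] * w x).

Lemma gauss_functional_is_linear : scalar gauss_functional.
Proof.
move=> c p q; rewrite /gauss_functional -RintegralZl//; last first.
  exact: integrable_poly_gauss.
rewrite -RintegralD//; last exact: integrable_poly_gauss.
  by apply: eq_Rintegral => x _; rewrite hornerD hornerZ mulrDl -mulrA.
have := integrable_poly_gauss (c *: p).
by apply: eq_integrable => // x _ /=; rewrite hornerZ -!mulrA.
Qed.

HB.instance Definition _ := GRing.isLinear.Build R {poly R} R _
  gauss_functional gauss_functional_is_linear.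

Lemma is_derive_poly_gauss (p : {poly R}) (x : R) :
  is_derive x (1 : R) (fun x => p.[x] * w x)
    ((p^`() - (2 * k%:num) *: ('X * p)).[x] * w x).
Proof.
have dw : is_derive x 1 w (w x * (- (2 * k%:num * x))).
  apply: (@is_derive1_comp _ expR (fun x => - (k%:num * x ^+ 2))).
  have := is_derive_poly (- (k%:num *: 'X^2)) x.
  rewrite derivN derivZ derivXn hornerN hornerZ hornerMn hornerXn expr1.
  rewrite -mulr_natl mulrA [k%:num * 2]mulrC.
  by congr is_derive; apply/funext => y; rewrite hornerN hornerZ hornerXn.
have := is_deriveM (is_derive_poly p x) dw.
congr is_derive; rewrite /GRing.scale/= hornerD hornerN hornerZ hornerM hornerX.
by move: (expR _) => E; move: k%:num => K; ring.
Qed.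

(** The sign [s], equal to 1 or -1, treats both ends of the real line at once. *)
Lemma cvg_poly_gauss (p : {poly R}) (s : R) : s ^+ 2 = 1 ->
  (p.[s * n%:R] * w (s * n%:R) @[n --> \oo] --> (0 : R))%classic.
Proof.
move=> s1.
have [C pC] := poly_gauss_bound k p.
have C0 : 0 <= C.
  by have := pC 0; rewrite expr0n/= !mulr0 oppr0 expR0 !mulr1; apply: le_trans.
apply/norm_cvg0P.
(* Since n <= n^2, the Gaussian bound at n is at most C r^n with r < 1. *)
pose r : R := expR (- (k%:num / 2)).
apply: (@squeeze_cvgr _ _ _ _ (fun=> 0) (fun n => C * r ^+ n)).
- apply: nearW => n; rewrite normr_ge0/=; apply: le_trans (pC _) _.
  rewrite ler_wpM2l// -expRM_natl ler_expR exprMn s1 mul1r.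
  rewrite mulrN lerN2 [leLHS]mulrC ler_wpM2l//.
  by rewrite -natrX ler_nat; case: n => // n; rewrite -{1}[n.+1]expn1 leq_pexp2l.
- exact: cvg_cst.
- rewrite -[X in (_ --> X)%classic](mulr0 C); apply: cvgM; first exact: cvg_cst.
  by apply: cvg_expr; rewrite ger0_norm ?expR_ge0// expR_lt1 oppr_lt0.
Qed.

(** The integrand is the derivative of p w. Its integrals over growing symmetric intervals tend to
    the full integral by dominated convergence, and to 0 because the boundary values of p w vanish
    in the limit. *)
Lemma gauss_functional_deriv (p : {poly R}) :
  gauss_functional (p^`() - (2 * k%:num) *: ('X * p)) = 0.
Proof.
set q := p^`() - _.
pose f x := q.[x] * w x.
(* The shift [n.+1] keeps the interval nondegenerate at n = 0, as the fundamental theorem of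
   calculus requires. *)
pose I n : set R := `[(- n.+1%:R : R), n.+1%:R]%classic.
have := @dominated_convergence _ _ _ mu setT measurableT
  (fun n => (EFin \o f) \_ (I n)) (EFin \o f) (fun x => `|(f x)%:E|)%E.
have mf : measurable_fun setT f.
  by apply: continuous_measurable_fun; exact: continuous_poly_gauss.
have pt x : ((EFin \o f) \_ (I n) x @[n --> \oo] --> (EFin \o f) x)%classic.
  (* At a fixed x the restricted functions are constant once n exceeds |x|. *)
  apply: cvg_near_cst; near=> n.
  rewrite patchE mem_set// /I /= in_itv/= -ler_norml.
  near: n; have [m xm] : exists m, `|x| <= m%:R.
    by exists (Num.truncn `|x|).+1; rewrite ltW// truncnS_gt.
  by exists m => // n /= mn; rewrite (le_trans xm)// ler_nat (leq_trans mn).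
case.
- move=> n; apply: (measurable_restrictT _ _).1; first exact: measurable_itv.
  by apply: measurable_funTS; exact/measurable_EFinP.
- exact/measurable_EFinP.
- by apply: aeW => x _; exact: pt.
- exact/integrable_abse/integrable_poly_gauss.
- apply: aeW => x n _; rewrite patchE; case: ifPn => // _.
  by rewrite abse0.
move=> _ _ lim1.
suff lim0 : (\int[mu]_x ((EFin \o f) \_ (I n)) x @[n --> \oo] --> 0)%E%classic.
  by rewrite /gauss_functional /Rintegral (cvg_unique _ lim1 lim0).
(* The factors 1 and -1 put the boundary values in the form of [cvg_poly_gauss]. *)
have FTC n : (\int[mu]_x ((EFin \o f) \_ (I n)) x)%E =
    (p.[1 * n.+1%:R] * w (1 * n.+1%:R) - p.[-1 * n.+1%:R] * w (-1 * n.+1%:R))%:E.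
  rewrite -integral_mkcond (@continuous_FTC2 _ _ (fun x => p.[x] * w x))//.
  - by rewrite EFinB mul1r mulN1r.
  - by rewrite (lt_trans (y:=0)) ?oppr_lt0.
  - by apply: continuous_subspaceT; exact: continuous_poly_gauss.
  - split.
    + move=> x _.
      exact: (@ex_derive _ _ _ _ _ _ _ (is_derive_poly_gauss p x)).
    + by apply: cvg_at_right_filter; exact: continuous_poly_gauss.
    + by apply: cvg_at_left_filter; exact: continuous_poly_gauss.
  - move=> x _; rewrite derive1E.
    exact: (@derive_val _ _ _ _ _ _ _ (is_derive_poly_gauss p x)).
under eq_fun do rewrite FTC.
apply: cvg_EFin; first exact: nearW.
rewrite -[X in (_ --> X)%classic](subr0 0); apply: cvgB.
  have := @cvg_poly_gauss p 1 (expr1n _ _).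
  by rewrite -(cvg_shiftS (fun n => p.[1 * n%:R] * w (1 * n%:R))).
have := @cvg_poly_gauss p (-1) (etrans (sqrrN 1) (expr1n _ _)).
by rewrite -(cvg_shiftS (fun n => p.[-1 * n%:R] * w (-1 * n%:R))).
Unshelve. all: by end_near.
Qed.

(** This supplies [L_ibp] with c = 1 / (2 k). *)
Lemma gauss_functional_mulX (p : {poly R}) :
  gauss_functional ('X * p) = (2 * k%:num)^-1 * gauss_functional p^`().
Proof.
have /eqP := gauss_functional_deriv p.
rewrite linearB linearZ/= subr_eq0 => /eqP ->.
by rewrite mulKf// gt_eqF// mulr_gt0.
Qed.

Lemma gauss_functional1 : gauss_functional 1 = Num.sqrt (pi / k%:num).
Proof.
rewrite -Rintegral_gauss; apply: eq_Rintegral => x _.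
by rewrite hornerE mul1r.
Qed.

End gaussian_functional.

(** * The determinant of [A11] *)

Section psi_gram.
Variables (R : realType) (T : R).

Lemma size_hermite n : (size (hermite R n) <= n.+1)%N.
Proof.
elim: n => [|n IH] /=; first by rewrite size_poly1.
rewrite (leq_trans (size_polyD _ _))// geq_max size_polyN.
rewrite (leq_trans (size_scale_leq _ _))
  ?(leq_trans (size_polyMleq _ _)) ?size_polyX//=.
by rewrite (leq_trans (size_poly _ _))// (leq_trans (leq_pred _))// ltnW.
Qed.

Lemma coef_hermite n : (hermite R n)`_n = 2 ^+ n.
Proof.
elim: n => [|n IH] /=; first by rewrite coef1.
rewrite coefB coefZ coefXM/= IH coef_deriv nth_default ?mul0rn ?subr0 ?exprS//.
exact: leq_trans (size_hermite n) _.
Qed.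

(** The polynomial factor of psi_n; dividing the coefficients by powers of [Num.sqrt T] performs the
    substitution v / sqrt T. *)
Definition psi_poly n : {poly R} :=
  (2 ^+ n * n`!%:R * Num.sqrt (pi * T)) `^ (- 2^-1) *:
  \poly_(i < n.+1) ((hermite R n)`_i / Num.sqrt T ^+ i).

Lemma size_psi_poly n : (size (psi_poly n) <= n.+1)%N.
Proof. by rewrite (leq_trans (size_scale_leq _ _))// size_poly. Qed.

Lemma psiE n v : psi T n v = (psi_poly n).[v] * expR (- (v ^+ 2 / T)).
Proof.
rewrite /psi hornerZ horner_poly (horner_coef_wide _ (size_hermite n)).
congr (_ * _ * _); apply: eq_bigr => i _.
by rewrite exprMn exprVn mulrA mulrAC.
Qed.

Hypothesis T0 : 0 < T.

(** Squaring turns the power -1/2 of the normalization into an inverse, and the 4^n from the leading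
    coefficient of H_n leaves 2^n. *)
Lemma psi_poly_coef_sqr n : (psi_poly n)`_n ^+ 2 =
  2 ^+ n / (n`!%:R * T ^+ n * Num.sqrt (pi * T)).
Proof.
have c0 : 0 < 2 ^+ n * n`!%:R * Num.sqrt (pi * T) :> R.
  by rewrite !mulr_gt0 ?exprn_gt0 ?ltr0n ?fact_gt0// sqrtr_gt0 mulr_gt0// pi_gt0.
have c2 (c : R) : 0 < c -> (c `^ (- 2^-1)) ^+ 2 = c^-1.
  move=> c_gt0; rewrite -powR_mulrn ?powR_ge0// -powRrM mulNr mulVf//.
  by rewrite powR_inv1// ltW.
rewrite coefZ coef_poly ltnSn coef_hermite !exprMn c2// exprVn.
rewrite [Num.sqrt T ^+ n ^+ 2]exprAC sqr_sqrtr ?ltW//.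
have f0 : n`!%:R != 0 :> R by rewrite pnatr_eq0 -lt0n fact_gt0.
have s0 : Num.sqrt (pi * T) != 0 by rewrite gt_eqF// sqrtr_gt0 mulr_gt0// pi_gt0.
have t0 : T ^+ n != 0 by rewrite expf_neq0// gt_eqF.
have p0 : 2 ^+ n != 0 :> R by rewrite expf_neq0.
move=> {c0 c2}.
move: (Num.sqrt _) (n`!%:R) (2 ^+ n) (T ^+ n) s0 f0 p0 t0 => s f p t s0 f0 p0 t0.
by field; rewrite s0 f0 p0 t0.
Qed.

Lemma det_A11 n : \det (A11 T n) = \prod_(i < n) 2 `^ (- i%:R - 2^-1).
Proof.
(* The two factors exp(- v^2 / T) multiply to the weight with k = 2 / T, hence c = T / 4. *)
have k0 : 0 < 2 / T by rewrite divr_gt0.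
pose k := PosNum k0.
have -> : A11 T n =
    \matrix_(i < n, j < n) gauss_functional k (psi_poly i * psi_poly j).
  apply/matrixP => i j; rewrite !mxE; apply: eq_Rintegral => v _.
  rewrite !psiE hornerM mulrACA -expRD; congr (_ * expR _) => /=.
  by field; rewrite gt_eqF.
rewrite (det_gram (@gauss_functional_mulX R k) n size_psi_poly).
(* Each factor is 2^i / (i! T^i sqrt(pi T)) times (T / 4)^i i! sqrt(pi T / 2), which reduces to 2^(-
   i) / sqrt 2. *)
apply: eq_bigr => i _.
rewrite [X in _ * (_ * X)]gauss_functional1 psi_poly_coef_sqr /=.
have -> : Num.sqrt (pi / (2 / T)) = Num.sqrt (pi * T) / Num.sqrt 2 :> R.
  by rewrite invf_div mulrA sqrtrM ?sqrtrV// mulr_ge0 ?pi_ge0// ltW.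
have -> : (2 * (2 / T))^-1 = T / 2 ^+ 2 by field; rewrite gt_eqF.
rewrite expr_div_n -exprM mulnC exprM.
rewrite powRB ?powRN ?powR_mulrn ?powR12_sqrt//; last first.
  by rewrite pnatr_eq0 implybT.
have f0 : i`!%:R != 0 :> R by rewrite pnatr_eq0 -lt0n fact_gt0.
have s0 : Num.sqrt (pi * T) != 0 by rewrite gt_eqF// sqrtr_gt0 mulr_gt0// pi_gt0.
have r0 : Num.sqrt 2 != 0 :> R by rewrite gt_eqF// sqrtr_gt0.
have t0 : T ^+ i != 0 by rewrite expf_neq0// gt_eqF.
have p0 : 2 ^+ i != 0 :> R by rewrite expf_neq0.
move: (Num.sqrt (pi * T)) (Num.sqrt 2) (i`!%:R) (2 ^+ i) (T ^+ i) s0 r0 f0 p0 t0.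
move=> s r f p t s0 r0 f0 p0 t0.
by field; rewrite s0 r0 f0 p0 t0.
Qed.

End psi_gram.

Theorem lemma5p2 (R : realType) (T : R) (hT : 0 < T) (N : nat) (hN : (1 <= N)%N) :
  let X : 'cV[R]_N := ursubmx (A11 T (N + 1)) in
  [/\ A11 T (N + 1) = block_mx (A11 T N) X X^T (a T N N)%:M,
      A11 T N \in unitmx,
      schur_compl (A11 T (N + 1)) =
        (a T N N)%:M - X^T *m invmx (A11 T N) *m X
    & schur_compl (A11 T (N + 1)) = (2 `^ (- N%:R - 2^-1))%:M].
Proof.
move=> X.
have ulE : ulsubmx (A11 T (N + 1)) = A11 T N.
  by apply/matrixP => i j; rewrite !mxE.
have dlE : dlsubmx (A11 T (N + 1)) = X^T.
  by apply/matrixP => i j; rewrite !mxE; apply: eq_Rintegral => v _; rewrite mulrC.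
have drE : drsubmx (A11 T (N + 1)) = (a T N N)%:M.
  by apply/matrixP => i j; rewrite !ord1 !mxE /= addn0.
have uA : A11 T N \in unitmx.
  rewrite unitmxE unitfE det_A11//; apply/prodf_neq0 => i _.
  by rewrite gt_eqF// powR_gt0.
split => //.
- by rewrite -[LHS]submxK ulE dlE drE.
- by rewrite /schur_compl ulE dlE drE.
(* Both expressions of the larger determinant contain the nonzero factor [\det (A11 T N)];
   cancelling it leaves the determinant of a 1 x 1 matrix, its only entry. *)
have := @det_schur_compl R N 1 (A11 T (N + 1)).
rewrite ulE => /(_ uA).
have -> : \det (A11 T (N + 1)) = \det (A11 T N) * 2 `^ (- N%:R - 2^-1).
  by rewrite !det_A11// addn1 big_ord_recr.
have /mulfI inj : \det (A11 T N) != 0 by rewrite -unitfE -unitmxE.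
move=> /inj ->.
by rewrite det_mx11 -mx11_scalar.
Qed.
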